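(* Let $\mathrm{D}^{Q}$ be a function assigning to every pair $(\rho,\sigma)$ of density operators on a common finite-dimensional Hilbert space a value $\mathrm{D}^{Q}(\rho\|\sigma)\in\mathbb{R}\cup\{+\infty\}$. Suppose: (M) for every CPTP map $\Lambda$ (between operators on finite-dimensional Hilbert spaces) and all $\rho,\sigma$ in its domain, $\mathrm{D}^{Q}(\rho\|\sigma)\ge \mathrm{D}^{Q}(\Lambda(\rho)\|\Lambda(\sigma))$; (N) for all probability distributions $p,q$ on a finite set, $\mathrm{D}^{Q}(p\|q)=\sum_x p(x)(\ln p(x)-\ln q(x))$; (A) for all $\rho,\sigma$ and all integers $n\ge1$, $\mathrm{D}^{Q}(\rho^{\otimes n}\|\sigma^{\otimes n})=n\,\mathrm{D}^{Q}(\rho\|\sigma)$. Then for all density operators $\rho,\sigma$ on a common finite-dimensional Hilbert space, $$\mathrm{D}(\rho\|\sigma)\le \mathrm{D}^{Q}(\rho\|\sigma)\le \mathrm{D}^{R}(\rho\|\sigma),$$ where $\mathrm{D}(\rho\|\sigma)=\mathrm{tr}\,\rho(\ln\rho-\ln\sigma)$ and $\mathrm{D}^{R}(\rho\|\sigma)=\mathrm{tr}\,\rho\ln\left(\sqrt{\rho}\,\sigma^{-1}\sqrt{\rho}\right)$.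
   Context: A probability distribution $p$ on a finite set $\mathcal{X}$ is identified with the diagonal density operator on $\mathbb{C}^{\mathcal{X}}$ with entries $p(x)$. CPTP means completely positive and trace preserving. In $\mathrm{D}^{R}$, $\sigma^{-1}$ is the generalized (Moore–Penrose) inverse and the logarithm is taken on $\mathrm{supp}\,\rho$. Conventions: $\mathrm{D}(\rho\|\sigma)=\mathrm{D}^{R}(\rho\|\sigma)=+\infty$ if $\mathrm{supp}\,\rho\not\subset\mathrm{supp}\,\sigma$ (likewise for classical relative entropy), and $0\ln 0=0$. *)

(* Defs.v *)
From mathcomp Require Import all_boot all_order all_algebra.
From mathcomp Require Import boolp reals constructive_ereal exp.
From mathcomp Require Export complex mxtens.
Set Implicit Arguments.
Unset Strict Implicit.
Unset Printing Implicit Defensive.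
Import Order.TTheory GRing.Theory Num.Theory.
Local Open Scope ring_scope.
Local Open Scope complex_scope.

(* Operators on the Hilbert space C^n are the matrices 'M[R[i]]_n, acting on
   column vectors, with R : realType and R[i] the complex numbers over R.
   On R[i], 0 <= z means that z is real and nonnegative. *)

Definition psdmx (R : realType) n (A : 'M[R[i]]_n) : Prop :=
  A \is hermsymmx /\
  forall v : 'cV[R[i]]_n, 0 <= (map_mx Num.conj v^T *m A *m v) 0 0.

Definition density (R : realType) n (rho : 'M[R[i]]_n) : Prop :=
  psdmx rho /\ \tr rho = 1.

Definition prob_dist (R : realType) n (p : 'I_n -> R) : Prop :=
  (forall x, 0 <= p x) /\ \sum_x p x = 1.

Definition diag_op (R : realType) n (p : 'I_n -> R) : 'M[R[i]]_n :=
  diag_mx (\row_x (p x)%:C).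

(* (id_k (x) L) X, where X = \sum_(i, j) E_ij (x) X_ij; see ampl_tens. *)
Definition ampl (R : realType) k n m (L : 'M[R[i]]_n -> 'M[R[i]]_m)
    (X : 'M[R[i]]_(k * n)) : 'M[R[i]]_(k * m) :=
  \sum_(i < k) \sum_(j < k) delta_mx i j *t
    L (\matrix_(a < n, b < n) X (mxtens_index (i, a)) (mxtens_index (j, b))).

Definition completely_positive (R : realType) n m
    (L : 'M[R[i]]_n -> 'M[R[i]]_m) : Prop :=
  forall k (X : 'M[R[i]]_(k * n)), psdmx X -> psdmx (ampl L X).

Definition trace_preserving (R : realType) n m
    (L : 'M[R[i]]_n -> 'M[R[i]]_m) : Prop :=
  forall X, \tr (L X) = \tr X.

Definition cptp (R : realType) n m
    (L : {linear 'M[R[i]]_n -> 'M[R[i]]_m}) : Prop :=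
  completely_positive L /\ trace_preserving L.

(* Functional calculus f(A) of a Hermitian matrix A; by mxfunE it does not
   depend on the chosen spectral decomposition. *)
Definition mxfun (R : realType) (f : R -> R) n (A : 'M[R[i]]_n) : 'M[R[i]]_n :=
  invmx (spectralmx A) *m
  diag_mx (map_mx (fun z => (f (complex.Re z))%:C) (spectral_diag A)) *m
  spectralmx A.

Definition mxsqrt (R : realType) n (A : 'M[R[i]]_n) := mxfun Num.sqrt A.

(* Since 0^-1 = 0, this is the Moore-Penrose inverse, see mxpinvP. *)
Definition mxpinv (R : realType) n (A : 'M[R[i]]_n) := mxfun GRing.inv A.

(* Since ln 0 = 0, this is, for A positive semidefinite, the logarithm taken on
   supp A, extended by 0 on the kernel of A. *)
Definition mxln (R : realType) n (A : 'M[R[i]]_n) := mxfun (@ln R) A.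

(* The support of a Hermitian operator is its range, i.e. its column space;
   (_ <= _)%MS compares row spaces, hence the transpositions. *)
Definition supp_sub (R : realType) n (rho sigma : 'M[R[i]]_n) : bool :=
  (rho^T <= sigma^T)%MS.

(* The traces below are real numbers. *)
Definition qrelent (R : realType) n (rho sigma : 'M[R[i]]_n) : \bar R :=
  if supp_sub rho sigma then
    (complex.Re (\tr (rho *m (mxln rho - mxln sigma))))%:E
  else +oo%E.

Definition qrelentR (R : realType) n (rho sigma : 'M[R[i]]_n) : \bar R :=
  if supp_sub rho sigma then
    (complex.Re (\tr (rho *m
       mxln (mxsqrt rho *m mxpinv sigma *m mxsqrt rho))))%:E
  else +oo%E.

Definition crelent (R : realType) n (p q : 'I_n -> R) : \bar R :=
  if [forall x, (q x == 0) ==> (p x == 0)] then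
    (\sum_x p x * (ln (p x) - ln (q x)))%:E
  else +oo%E.

Lemma ampl_tens (R : realType) k n m (L : {linear 'M[R[i]]_n -> 'M[R[i]]_m})
    (A : 'M[R[i]]_k) (B : 'M[R[i]]_n) : ampl L (A *t B) = A *t L B.
Proof.
have E i j : \matrix_(a < n, b < n)
    (A *t B) (mxtens_index (i, a)) (mxtens_index (j, b)) = A i j *: B.
  by apply/matrixP => a b; rewrite mxE tensmxE mxE.
apply/matrixP => s t; rewrite /ampl summxE.
under eq_bigr => i _.
  rewrite summxE; under eq_bigr => j _ do rewrite E linearZ /= !mxE.
  over.
rewrite mxE (bigD1 (mxtens_unindex s).1) //= (bigD1 (mxtens_unindex t).1) //=.
rewrite !eqxx mul1r big1 => [|j /negPf jt].
  rewrite big1 ?addr0 // => i /negPf si; rewrite big1 // => j _.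
  by rewrite [_ == i]eq_sym si mul0r.
by rewrite [_ == j]eq_sym jt andbF mul0r.
Qed.

Lemma diag_mx_fun_uniq (C : fieldType) n (A P U : 'M[C]_n) (D E F G : 'rV[C]_n) :
  P \in unitmx -> U \in unitmx ->
  A = invmx P *m diag_mx D *m P -> A = invmx U *m diag_mx E *m U ->
  (forall i j, D 0 i = E 0 j -> F 0 i = G 0 j) ->
  invmx P *m diag_mx F *m P = invmx U *m diag_mx G *m U.
Proof.
move=> PU UU -> DE FG; set W := P *m invmx U.
have DW : diag_mx D *m W = W *m diag_mx E.
  have := congr1 (fun X => P *m X *m invmx U) DE.
  by rewrite !mulmxA (mulmxV PU) mul1mx (mulmxK UU) -[LHS]mulmxA.
have FW : diag_mx F *m W = W *m diag_mx G.
  apply/matrixP => i j; move/matrixP/(_ i j): DW.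
  rewrite !mul_diag_mx !mul_mx_diag !mxE; set w := \sum_(_ < _) _.
  have [->|w0] := eqVneq w 0; first by rewrite !mulr0 !mul0r.
  by rewrite [w * _]mulrC => /(mulIf w0)/FG ->; rewrite mulrC.
have := congr1 (fun X => invmx P *m X *m U) FW.
by rewrite /W !mulmxA (mulmxKV UU) (mulVmx PU) mul1mx.
Qed.

Lemma mulmx_conj_diag (C : fieldType) n (P : 'M[C]_n) (d e : 'rV[C]_n) :
  P \in unitmx ->
  (invmx P *m diag_mx d *m P) *m (invmx P *m diag_mx e *m P) =
  invmx P *m diag_mx (\row_j (d 0 j * e 0 j)) *m P.
Proof.
by move=> PU; rewrite !mulmxA (mulmxK PU) -(mulmxA (invmx P)) mulmx_diag.
Qed.

Lemma hermitian_conj_diag (C : numClosedFieldType) n (P : 'M[C]_n)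
    (d : 'rV[C]_n) : P \is unitarymx -> (forall j, d 0 j \is Num.real) ->
  invmx P *m diag_mx d *m P \is hermsymmx.
Proof.
move=> uP rd; apply/is_hermitianmxP; rewrite expr0 scale1r.
have dd : map_mx Num.conj d = d.
  by apply/rowP => j; rewrite mxE; exact/CrealP.
rewrite !trmx_mul !map_mxM tr_diag_mx map_diag_mx mulmxA invmx_unitary //.
by rewrite map_trmx trmxK -map_mx_comp (map_mx_id (@conjCK _)) dd.
Qed.

Lemma penrose_conj_diag (C : numClosedFieldType) n (A B P : 'M[C]_n)
    (d e : 'rV[C]_n) :
  P \is unitarymx -> (forall j, d 0 j \is Num.real) ->
  (forall j, e 0 j = (d 0 j)^-1) ->
  A = invmx P *m diag_mx d *m P -> B = invmx P *m diag_mx e *m P ->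
  [/\ A *m B *m A = A, B *m A *m B = B,
      A *m B \is hermsymmx & B *m A \is hermsymmx].
Proof.
move=> uP rd eE -> ->; have PU := unitarymx_unit uP.
rewrite !(mulmx_conj_diag _ _ PU).
have E1 : \row_j ((\row_j (d 0 j * e 0 j)) 0 j * d 0 j) = d.
  apply/rowP => j; rewrite !mxE eE.
  by have [->|d0] := eqVneq (d 0 j) 0; rewrite ?mulr0 // divfK.
have E2 : \row_j ((\row_j (e 0 j * d 0 j)) 0 j * e 0 j) = e.
  apply/rowP => j; rewrite !mxE eE.
  have [->|d0] := eqVneq (d 0 j) 0; first by rewrite invr0 mulr0.
  by rewrite mulVf // mul1r.
rewrite E1 E2; split=> //; apply: hermitian_conj_diag => // j.
  by rewrite !mxE eE realM ?realV.
by rewrite !mxE eE realM ?realV.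
Qed.

Lemma mxfunE (R : realType) (f : R -> R) n (A U : 'M[R[i]]_n) (d : 'rV[R]_n) :
  U \is unitarymx ->
  A = invmx U *m diag_mx (map_mx (real_complex R) d) *m U ->
  mxfun f A = invmx U *m diag_mx (map_mx (fun x => (f x)%:C) d) *m U.
Proof.
move=> uU AE; have /orthomx_spectralP AP : A \is normalmx.
  apply/orthomx_spectral_subproof.
  by exists (U, map_mx (real_complex R) d).
rewrite /mxfun; apply: (diag_mx_fun_uniq (spectral_unit A)
  (unitarymx_unit uU) AP AE).
by move=> i j; rewrite !mxE => ->.
Qed.

Lemma mxpinvP (R : realType) n (A : 'M[R[i]]_n) : A \is hermsymmx ->
  [/\ A *m mxpinv A *m A = A,
      mxpinv A *m A *m mxpinv A = mxpinv A,
      A *m mxpinv A \is hermsymmx &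
      mxpinv A *m A \is hermsymmx].
Proof.
move=> hA; have /orthomx_spectralP AE := hermitian_normalmx hA.
have /mxOverP dR := hermitian_spectral_diag_real hA.
apply: (penrose_conj_diag (spectral_unitarymx A) (dR 0) _ AE erefl) => j.
by rewrite mxE fmorphV /= RRe_real.
Qed.

(* Main.v *)
(* Upper bound: diagonalise T = sigma^(-1/2) rho sigma^(-1/2) = sum_i t_i e_i e_i^*
   and let q_i = <e_i, sigma e_i>.  Preparing the normalised vector
   sigma^(1/2) e_i on input i maps (q_i) to sigma and (t_i q_i) to rho, and the
   classical relative entropy of these distributions is exactly D^R.

   Lower bound: in an eigenbasis of sigma^(tensor k), the pinching of
   rho^(tensor k) to the eigenspaces of sigma^(tensor k) is diagonal for a
   suitable choice of basis.  Measuring in that basis loses at most the logarithm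
   of the number of distinct eigenvalues of sigma^(tensor k), which is at most
   n ln (k + 1) and disappears after division by k.  The loss is estimated with
   ln x <= x - 1 and the inequality tr (A^2 B^-1) <= v tr A, where B is the
   pinching of A to v blocks; it comes from Schur complements. *)

Require Import Defs.
From HB Require Import structures.
From mathcomp Require Import all_boot all_order all_algebra.
From mathcomp Require Import boolp reals constructive_ereal exp.
From mathcomp Require Import complex mxtens.
From mathcomp Require Import ring lra.
Set Implicit Arguments.
Unset Strict Implicit.
Unset Printing Implicit Defensive.
Import Order.TTheory GRing.Theory Num.Theory.
Local Open Scope ring_scope.

(** * Conjugate transposes, unitary matrices and tensor products *)

Section ConjugateTranspose.
Local Open Scope sesquilinear_scope.
Context {C : numClosedFieldType}.

Lemma hermsymmxP n (A : 'M[C]_n) : reflect (A ^t* = A) (A \is hermsymmx).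
Proof.
have E : reflect (A = A ^t*) (A \is hermsymmx).
  by have := is_hermitianmxP false Num.conj A; rewrite expr0 scale1r.
by apply: (iffP E) => /esym.
Qed.

Lemma adjmxM m n p (A : 'M[C]_(m, n)) (B : 'M[C]_(n, p)) :
  (A *m B) ^t* = B ^t* *m A ^t*.
Proof. by rewrite trmx_mul map_mxM. Qed.

Lemma adjmxD m n (A B : 'M[C]_(m, n)) : (A + B) ^t* = A ^t* + B ^t*.
Proof. by rewrite linearD map_mxD. Qed.

Lemma adjmxZ m n (a : C) (A : 'M[C]_(m, n)) : (a *: A) ^t* = a^* *: A ^t*.
Proof. by apply/matrixP => i j; rewrite !mxE; exact: rmorphM. Qed.

Lemma adjmxE m n (A : 'M[C]_(m, n)) i j : (A ^t*) i j = (A j i)^*.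
Proof. by rewrite !mxE. Qed.

Lemma adj_tensmx m n p q (A : 'M[C]_(m, n)) (B : 'M[C]_(p, q)) :
  (A *t B) ^t* = A ^t* *t B ^t*.
Proof. by rewrite trmx_tens map_mxT. Qed.

Lemma tens1mx m n : 1%:M *t 1%:M = 1%:M :> 'M[C]_(m * n).
Proof.
apply/matrixP=> i j.
case: (mxtens_indexP i) => [i1 i2]; case: (mxtens_indexP j) => [j1 j2].
rewrite tensmxE !mxE (can_eq (@mxtens_indexK _ _)) xpair_eqE.
by do 2!case: eqP; rewrite ?(mulr1, mulr0).
Qed.

Lemma unitary_tensmx m n (U : 'M[C]_m) (V : 'M[C]_n) :
  U \is unitarymx -> V \is unitarymx -> U *t V \is unitarymx.
Proof.
move=> /unitarymxP uU /unitarymxP uV; apply/unitarymxP.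
by rewrite adj_tensmx tensmx_mul uU uV tens1mx.
Qed.

Lemma unitary_adjM n (U : 'M[C]_n) : U \is unitarymx -> U ^t* *m U = 1%:M.
Proof. by move=> uU; rewrite -invmx_unitary ?mulVmx ?unitarymx_unit. Qed.

Lemma unitary_row_sqr n (U : 'M[C]_n) i :
  U \is unitarymx -> \sum_j `|U i j| ^+ 2 = 1.
Proof.
move=> /unitarymxP/matrixP/(_ i i); rewrite !mxE eqxx mulr1n => <-.
by apply: eq_bigr => j _; rewrite normCK !mxE.
Qed.

Lemma mxtrace_tens m n (A : 'M[C]_m) (B : 'M[C]_n) :
  \tr (A *t B) = \tr A * \tr B.
Proof. by rewrite /mxtrace mulr_sum; apply: eq_bigr => i _; rewrite mxE. Qed.

Lemma mxtrace_mulmxBr n (A B D : 'M[C]_n) :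
  \tr (A *m (B - D)) = \tr (A *m B) - \tr (A *m D).
Proof. by rewrite mulmxBr raddfB. Qed.

End ConjugateTranspose.

(** * Positive matrices, eigenbases and the functional calculus *)

Section PositiveMatrices.
Local Open Scope sesquilinear_scope.
Local Open Scope complex_scope.
Context {R : realType}.
Local Notation C := R[i].

Lemma conjC_real (x : R) : (x%:C : C)^*%R = x%:C.
Proof. by apply: CrealP; apply/complex_realP; exists x. Qed.

Lemma Re_ge0K (z : C) : 0 <= z -> (complex.Re z)%:C = z.
Proof. by move=> z0; rewrite RRe_real // ger0_real. Qed.

Lemma psdmx_conj m n (A : 'M[C]_n) (K : 'M[C]_(n, m)) :
  psdmx A -> psdmx (K ^t* *m A *m K).
Proof.
move=> [/hermsymmxP hA pA]; split.
  by apply/hermsymmxP; rewrite !adjmxM trmxCK hA mulmxA.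
by move=> v; have := pA (K *m v); rewrite adjmxM !mulmxA.
Qed.

Lemma psdmx0 n : psdmx (0 : 'M[C]_n).
Proof.
split; first by apply/hermsymmxP; rewrite trmx0 map_mx0.
by move=> v; rewrite mulmx0 mul0mx mxE.
Qed.

Lemma psdmxD n (A B : 'M[C]_n) : psdmx A -> psdmx B -> psdmx (A + B).
Proof.
move=> [/hermsymmxP hA pA] [/hermsymmxP hB pB]; split.
  by apply/hermsymmxP; rewrite adjmxD hA hB.
by move=> v; rewrite mulmxDr mulmxDl mxE addr_ge0.
Qed.

Lemma psdmx_sum (I : finType) n (F : I -> 'M[C]_n) :
  (forall i, psdmx (F i)) -> psdmx (\sum_i F i).
Proof.
by move=> pF; apply: big_ind => [|A B|i _]; [exact: psdmx0|exact: psdmxD|exact: pF].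
Qed.

Lemma adj_diag_op n (d : 'I_n -> R) : (diag_op d) ^t* = diag_op d.
Proof.
rewrite /diag_op tr_diag_mx map_diag_mx; congr diag_mx.
by apply/rowP => i; rewrite !mxE; exact: conjC_real.
Qed.

Lemma diag_opM n (d e : 'I_n -> R) :
  diag_op d *m diag_op e = diag_op (fun i => d i * e i).
Proof.
by rewrite /diag_op mulmx_diag; congr diag_mx; apply/rowP => i; rewrite !mxE rmorphM.
Qed.

Lemma mul_diag_opE m n (d : 'I_m -> R) (A : 'M[C]_(m, n)) i j :
  (diag_op d *m A) i j = (d i)%:C * A i j.
Proof. by rewrite /diag_op mul_diag_mx !mxE. Qed.

Lemma mul_mx_diag_opE m n (d : 'I_n -> R) (A : 'M[C]_(m, n)) i j :
  (A *m diag_op d) i j = A i j * (d j)%:C.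
Proof. by rewrite /diag_op mul_mx_diag !mxE. Qed.

Lemma mxtrace_diag_op n (d : 'I_n -> R) : \tr (diag_op d) = (\sum_i d i)%:C.
Proof. by rewrite /diag_op mxtrace_diag rmorph_sum; apply: eq_bigr => i _; rewrite mxE. Qed.

Lemma psdmx_diag_ge0 n (A : 'M[C]_n) i : psdmx A -> 0 <= A i i.
Proof.
case=> _ /(_ (delta_mx i 0)); rewrite trmx_delta map_delta_mx -rowE -colE.
by rewrite !mxE.
Qed.

Lemma psdmx_diag_op n (d : 'I_n -> R) : psdmx (diag_op d) <-> (forall i, 0 <= d i).
Proof.
split=> [pd i|d0].
  by have := psdmx_diag_ge0 i pd; rewrite !mxE eqxx mulr1n ler0c.
split; first by apply/hermsymmxP; exact: adj_diag_op.
move=> v; rewrite -mulmxA mxE sumr_ge0 // => i _.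
by rewrite mul_diag_opE !mxE mulrCA mulr_ge0 ?ler0c // mulrC mul_conjC_ge0.
Qed.

(** The columns of the adjoint of [U] are the eigenvectors. Unlike in [spectralmx], the eigenbasis
    is free, so that a tensor product of eigenbases can serve as eigenbasis of the tensor
    product. *)
Definition diagonalizes n (U : 'M[C]_n) (d : 'I_n -> R) (A : 'M[C]_n) :=
  U \is unitarymx /\ A = U ^t* *m diag_op d *m U.

Lemma diagonalizes_conj n (U : 'M[C]_n) d A :
  diagonalizes U d A -> U *m A *m U ^t* = diag_op d.
Proof.
move=> [uU ->]; have /unitarymxP UU := uU.
by rewrite !mulmxA UU mul1mx -mulmxA UU mulmx1.
Qed.

Lemma hermsymmx_diagonalizes n (A : 'M[C]_n) :
  A \is hermsymmx -> exists U d, diagonalizes U d A.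
Proof.
move=> hA; have /orthomx_spectralP AE := hermitian_normalmx hA.
have /mxOverP dR := hermitian_spectral_diag_real hA.
exists (spectralmx A), (fun i => complex.Re (spectral_diag A 0 i)).
split; first exact: spectral_unitarymx.
rewrite -(invmx_unitary (spectral_unitarymx A)).
apply: (etrans AE).
suff {1}-> : spectral_diag A = \row_i (complex.Re (spectral_diag A 0 i))%:C by [].
by apply/rowP => i; rewrite !mxE RRe_real.
Qed.

Lemma psdmx_diagonalizes n (A : 'M[C]_n) :
  psdmx A -> exists U d, diagonalizes U d A /\ forall i, 0 <= d i.
Proof.
move=> pA; have [U [d Ud]] := hermsymmx_diagonalizes pA.1.
exists U, d; split => //; apply/psdmx_diag_op.
by rewrite -(diagonalizes_conj Ud) -{1}[U]trmxCK; exact: psdmx_conj.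
Qed.

Lemma diagonalizes_psdmx n (U : 'M[C]_n) d A :
  diagonalizes U d A -> (forall i, 0 <= d i) -> psdmx A.
Proof. by move=> [uU ->] d0; apply: psdmx_conj; apply/psdmx_diag_op. Qed.

Lemma diagonalizes_tr n (U : 'M[C]_n) d A :
  diagonalizes U d A -> \tr A = (\sum_i d i)%:C.
Proof.
move=> [uU ->]; rewrite mxtrace_mulC mulmxA (unitarymxP uU) mul1mx.
exact: mxtrace_diag_op.
Qed.

Lemma tens_diag_op m n (d : 'I_m -> R) (e : 'I_n -> R) :
  diag_op d *t diag_op e =
  diag_op (fun i => d (mxtens_unindex i).1 * e (mxtens_unindex i).2).
Proof.
apply/matrixP=> i j.
case: (mxtens_indexP i) => [i1 i2]; case: (mxtens_indexP j) => [j1 j2].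
rewrite tensmxE !mxE !mxtens_indexK /= (can_eq (@mxtens_indexK _ _)) xpair_eqE.
by do 2!case: eqP => _ //=; rewrite ?mulr1n ?mulr0n ?mulr0 ?mul0r // rmorphM.
Qed.

Lemma diagonalizes_tens m n (U : 'M[C]_m) (V : 'M[C]_n) d e A B :
  diagonalizes U d A -> diagonalizes V e B ->
  diagonalizes (U *t V)
    (fun i => d (mxtens_unindex i).1 * e (mxtens_unindex i).2) (A *t B).
Proof.
move=> [uU ->] [uV ->]; split; first exact: unitary_tensmx.
by rewrite -tens_diag_op -tensmx_mul -tensmx_mul adj_tensmx.
Qed.

Lemma density_tens m n (A : 'M[C]_m) (B : 'M[C]_n) :
  density A -> density B -> density (A *t B).
Proof.
move=> [pA tA] [pB tB]; split; last by rewrite mxtrace_tens tA tB mulr1.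
have [U [d [Ud d0]]] := psdmx_diagonalizes pA.
have [V [e [Ve e0]]] := psdmx_diagonalizes pB.
by apply: diagonalizes_psdmx (diagonalizes_tens Ud Ve) _ => i; rewrite mulr_ge0.
Qed.

Lemma mxfun_diagonalizes (f : R -> R) n (U : 'M[C]_n) d A :
  diagonalizes U d A -> mxfun f A = U ^t* *m diag_op (fun i => f (d i)) *m U.
Proof.
move=> [uU AE].
have dE (g : R -> R) : diag_op (fun i => g (d i)) =
    diag_mx (map_mx (fun x => (g x)%:C) (\row_i d i)).
  by rewrite /diag_op; congr diag_mx; apply/rowP => i; rewrite !mxE.
rewrite (dE f).
rewrite -(invmx_unitary uU).
apply: (mxfunE f uU).
rewrite (invmx_unitary uU) AE.
by have /= <- := dE id.
Qed.

(** In eigenbases of [A] and [B] the hypothesis says that an entry of [X] can be nonzero only where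
    the two eigenvalues agree, and there the values of [f] agree too. *)
Lemma mxfun_intertwine (f : R -> R) m n (A : 'M[C]_m) (B : 'M[C]_n)
    (X : 'M[C]_(n, m)) :
  A \is hermsymmx -> B \is hermsymmx -> X *m A = B *m X ->
  X *m mxfun f A = mxfun f B *m X.
Proof.
move=> /hermsymmx_diagonalizes[U [d UdA]] /hermsymmx_diagonalizes[V [e VeB]].
rewrite (mxfun_diagonalizes f UdA) (mxfun_diagonalizes f VeB).
move: UdA VeB => [uU ->] [uV ->].
have [W ->] : exists W, X = V ^t* *m W *m U.
  exists (V *m X *m U ^t*).
  by rewrite !mulmxA unitary_adjM // mul1mx -mulmxA unitary_adjM // mulmx1.
have cancelU D : V ^t* *m W *m U *m (U ^t* *m D *m U) = V ^t* *m (W *m D) *m U.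
  by rewrite !mulmxA (mulmxtVK _ uU).
have cancelV D : V ^t* *m D *m V *m (V ^t* *m W *m U) = V ^t* *m (D *m W) *m U.
  by rewrite !mulmxA (mulmxtVK _ uV).
move=> E; have {}E := etrans (esym (cancelU _)) (etrans E (cancelV _)).
apply: (etrans (cancelU _)); apply: (etrans _ (esym (cancelV _))).
apply: (congr1 (fun Y => V ^t* *m Y *m U)).
have WE : W *m diag_op d = diag_op e *m W.
  have := congr1 (fun Y => V *m Y *m U ^t*) E; rewrite !mulmxA.
  by rewrite (unitarymxP uV) !mul1mx !(mulmxtVK _ uU).
apply/matrixP => i j; rewrite (mul_mx_diag_opE _ W) (mul_diag_opE _ W).
move/matrixP/(_ i j): WE; rewrite (mul_mx_diag_opE _ W) (mul_diag_opE _ W).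
have [->|w0] := eqVneq (W i j) 0; first by rewrite !mulr0 !mul0r.
by rewrite mulrC => /(mulIf w0)/complexI ->; rewrite mulrC.
Qed.

End PositiveMatrices.

(** * Kraus maps and complete positivity *)

Section KrausMaps.
Local Open Scope sesquilinear_scope.
Local Open Scope complex_scope.
Context {R : realType}.
Local Notation C := R[i].

Definition kraus r m n (K : 'I_r -> 'M[C]_(m, n)) (X : 'M[C]_n) : 'M[C]_m :=
  \sum_l K l *m X *m (K l) ^t*.

Fact kraus_is_linear r m n (K : 'I_r -> 'M[C]_(m, n)) : linear (kraus K).
Proof.
move=> a X Y; rewrite /kraus scaler_sumr -big_split /=; apply: eq_bigr => l _.
by rewrite mulmxDr mulmxDl -scalemxAr -scalemxAl.
Qed.

HB.instance Definition _ r m n (K : 'I_r -> 'M[C]_(m, n)) :=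
  GRing.isLinear.Build C 'M[C]_n 'M[C]_m *:%R (kraus K) (kraus_is_linear K).

Lemma tensmx_blocks k n (X : 'M[C]_(k * n)) :
  \sum_(i < k) \sum_(j < k) delta_mx i j *t
    (\matrix_(a < n, b < n) X (mxtens_index (i, a)) (mxtens_index (j, b))) = X.
Proof.
apply/matrixP=> s t.
case: (mxtens_indexP s) => [i a]; case: (mxtens_indexP t) => [j b].
rewrite summxE (bigD1 i) //= summxE (bigD1 j) //= tensmxE !mxE !eqxx mul1r.
rewrite big1 => [|j' /negPf jj]; last first.
  by rewrite tensmxE !mxE [j == _]eq_sym jj andbF mul0r.
rewrite big1 ?addr0 // => i' /negPf ii; rewrite summxE big1 // => j' _.
by rewrite tensmxE !mxE [i == _]eq_sym ii mul0r.
Qed.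

Lemma tensmx_sumr (I : finType) m n p q (A : 'M[C]_(m, n)) (F : I -> 'M[C]_(p, q)) :
  A *t (\sum_i F i) = \sum_i A *t F i.
Proof.
apply/matrixP=> s t; rewrite mxE !summxE mulr_sumr.
by apply: eq_bigr => l _; rewrite mxE.
Qed.

(** Conjugation by 1 (x) K_l leaves the factor E_ij of each block untouched. Complete positivity of
    a Kraus map thereby reduces to positivity of another Kraus map. *)
Lemma ampl_kraus k r m n (K : 'I_r -> 'M[C]_(m, n)) (X : 'M[C]_(k * n)) :
  ampl (kraus K) X = kraus (fun l => 1%:M *t K l) X.
Proof.
pose blk i j := \matrix_(a < n, b < n) X (mxtens_index (i, a)) (mxtens_index (j, b)).
have E l : (1%:M *t K l) *m X *m (1%:M *t K l) ^t* =
    \sum_(i < k) \sum_(j < k) delta_mx i j *t (K l *m blk i j *m (K l) ^t*).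
  rewrite -[in LHS](tensmx_blocks X) mulmx_sumr mulmx_suml; apply: eq_bigr => i _.
  rewrite mulmx_sumr mulmx_suml; apply: eq_bigr => j _.
  by rewrite adj_tensmx !tensmx_mul trmx1 map_mx1 mul1mx mulmx1.
rewrite /kraus /ampl; under [RHS]eq_bigr do rewrite E.
rewrite [RHS]exchange_big /=; apply: eq_bigr => i _.
rewrite [RHS]exchange_big /=; apply: eq_bigr => j _.
by rewrite tensmx_sumr.
Qed.

Lemma kraus_psdmx r m n (K : 'I_r -> 'M[C]_(m, n)) (X : 'M[C]_n) :
  psdmx X -> psdmx (kraus K X).
Proof.
move=> pX; apply: psdmx_sum => l; rewrite -{1}[K l]trmxCK; exact: psdmx_conj.
Qed.

Lemma cptp_kraus r m n (K : 'I_r -> 'M[C]_(m, n)) :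
  \sum_l (K l) ^t* *m K l = 1%:M -> cptp (kraus K : {linear _ -> _}).
Proof.
move=> K1; split=> [k X pX|X]; first by rewrite ampl_kraus; exact: kraus_psdmx.
rewrite /= /kraus raddf_sum /=.
under eq_bigr do rewrite mxtrace_mulC mulmxA.
by rewrite -raddf_sum /= -mulmx_suml K1 mul1mx.
Qed.

End KrausMaps.

(** * Measurement and preparation channels *)

Section MeasureAndPrepare.
Local Open Scope sesquilinear_scope.
Local Open Scope complex_scope.
Context {R : realType}.
Local Notation C := R[i].

Lemma adjmx_scale_real m n (a : R) (A : 'M[C]_(m, n)) : (a%:C *: A) ^t* = a%:C *: A ^t*.
Proof. by apply/matrixP=> i j; rewrite !mxE rmorphM; congr (_ * _); exact: conjC_real. Qed.

Lemma adj_delta_mx m n i j : (delta_mx i j : 'M[C]_(m, n)) ^t* = delta_mx j i.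
Proof. by rewrite trmx_delta map_delta_mx. Qed.

Lemma sum_delta_mx n : \sum_l delta_mx l l = 1%:M :> 'M[C]_n.
Proof.
apply/matrixP=> i j; rewrite summxE (bigD1 i) //= big1 => [|l /negPf li].
  by rewrite !mxE eqxx addr0 eq_sym.
by rewrite mxE eq_sym li.
Qed.

Lemma delta_mx_sandwich m n p q (Y : 'M[C]_(n, p)) (i : 'I_m) j k (l : 'I_q) :
  delta_mx i j *m Y *m delta_mx k l = Y j k *: delta_mx i l.
Proof.
rewrite -(mul_delta_mx (0 : 'I_1) i j) -(mul_delta_mx (0 : 'I_1) k l) !mulmxA.
rewrite -(mulmxA _ (delta_mx 0 j)) -rowE -(mulmxA _ (row j Y)) -colE.
have -> : col k (row j Y) = (Y j k)%:M.
  by apply/matrixP=> a b; rewrite !ord1 !mxE mulr1n.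
by rewrite mul_mx_scalar -scalemxAl mul_delta_mx.
Qed.

(** The Kraus operators E_ll W measure in an orthonormal basis and record the outcome l as a
    diagonal entry. *)
Lemma measurement n (W : 'M[C]_n) : W \is unitarymx ->
  exists L : {linear 'M[C]_n -> 'M[C]_n}, cptp L /\
    forall X, L X = diag_mx (\row_l (W *m X *m W ^t*) l l).
Proof.
move=> uW; pose K l := delta_mx l l *m W; exists (kraus K); split.
  apply: cptp_kraus.
  under eq_bigr => l _.
    rewrite adjmxM adj_delta_mx mulmxA -[W ^t* *m _ *m _]mulmxA mul_delta_mx.
    over.
  by rewrite -mulmx_suml -mulmx_sumr sum_delta_mx mulmx1 unitary_adjM.
move=> X; rewrite diag_mx_sum_delta; apply: eq_bigr => l _.
rewrite adjmxM adj_delta_mx mxE -delta_mx_sandwich.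
by rewrite !mulmxA.
Qed.

Lemma diag_op_diag n (d : 'I_n -> R) i : diag_op d i i = (d i)%:C.
Proof. by rewrite !mxE eqxx mulr1n. Qed.

Lemma mulmx_diag_sum m n (F : 'M[C]_(m, n)) (d : 'I_n -> R) :
  F *m diag_op d *m F ^t* = \sum_i (d i)%:C *: (col i F *m (col i F) ^t*).
Proof.
apply/matrixP=> i j; rewrite mxE summxE; apply: eq_bigr => k _.
rewrite mul_mx_diag_opE !mxE big_ord1 !mxE; ring.
Qed.

Lemma mxtrace_mul_diag m n (F : 'M[C]_(m, n)) (d : 'I_n -> R) (G : 'M[C]_(n, m)) :
  \tr (F *m diag_op d *m G) = \sum_i (d i)%:C * (G *m F) i i.
Proof.
rewrite -mulmxA mxtrace_mulC -mulmxA; apply: eq_bigr => i _.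
exact: mul_diag_opE.
Qed.

(* Prepares the normalised i-th column of F on input i. *)
Lemma preparation n (F : 'M[C]_n) (q : 'I_n -> R) :
  (forall i, (F ^t* *m F) i i = (q i)%:C) ->
  exists L : {linear 'M[C]_n -> 'M[C]_n}, cptp L /\
    forall t, L (diag_op (fun i => t i * q i)) = F *m diag_op t *m F ^t*.
Proof.
move=> Fq.
have colE i : (col i F) ^t* *m col i F = (q i)%:C%:M.
  apply/matrixP=> a b; rewrite !ord1 [RHS]mxE eqxx mulr1n -Fq !mxE.
  by apply: eq_bigr => k _; rewrite !mxE.
have q0 i : 0 <= q i.
  rewrite -(@ler0c R) -Fq mxE sumr_ge0 // => k _.
  by rewrite !mxE mulrC mul_conjC_ge0.
have col0 i : q i = 0 -> col i F = 0.
  move=> qi; apply/matrixP=> a b; rewrite !mxE; apply/eqP.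
  have := Fq i; rewrite qi mxE => /eqP; rewrite psumr_eq0 => [/allP/(_ a)|k _].
    by rewrite mem_index_enum !mxE mulrC mul_conjC_eq0; apply.
  by rewrite !mxE mulrC mul_conjC_ge0.
(* If q_i = 0, the column vanishes and cannot be normalised; any unit vector then keeps the map
   trace preserving, and the weight 0 hides the choice. *)
pose psi i : 'cV[C]_n :=
  if q i == 0 then delta_mx i 0 else (Num.sqrt (q i))^-1%:C *: col i F.
have psi1 i : (psi i) ^t* *m psi i = 1%:M.
  rewrite /psi; case: eqVneq => [_|qi].
    by rewrite adj_delta_mx mul_delta_mx -sum_delta_mx big_ord1.
  have s0 : Num.sqrt (q i) != 0 by rewrite sqrtr_eq0 -ltNge lt_def qi q0.
  rewrite adjmx_scale_real -scalemxAl -scalemxAr scalerA colE.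
  rewrite scale_scalar_mx -!rmorphM.
  by rewrite -[X in _ * X](sqr_sqrtr (q0 i)) expr2 mulrACA !mulVf // mulr1.
have psiE i : (q i)%:C *: (psi i *m (psi i) ^t*) = col i F *m (col i F) ^t*.
  rewrite /psi; case: eqVneq => [qi|qi]; first by rewrite qi col0 // scale0r mul0mx.
  have s0 : Num.sqrt (q i) != 0 by rewrite sqrtr_eq0 -ltNge lt_def qi q0.
  rewrite adjmx_scale_real -scalemxAl -scalemxAr !scalerA -!rmorphM.
  rewrite -{1}(sqr_sqrtr (q0 i)) expr2 -mulrA mulrACA !divff // mulr1.
  by rewrite rmorph1 scale1r.
exists (kraus (fun i => psi i *m delta_mx 0 i)); split.
  apply: cptp_kraus; rewrite -[RHS]sum_delta_mx; apply: eq_bigr => i _.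
  rewrite adjmxM adj_delta_mx mulmxA -(mulmxA (delta_mx i 0)) psi1 mulmx1.
  by rewrite mul_delta_mx.
move=> t; rewrite mulmx_diag_sum; apply: eq_bigr => i _.
rewrite adjmxM adj_delta_mx mulmxA -(mulmxA (psi i)) -(mulmxA (psi i)).
have e1 : delta_mx 0 0 = 1%:M :> 'M[C]_1 by rewrite -sum_delta_mx big_ord1.
rewrite delta_mx_sandwich diag_op_diag e1 -scalemxAr mulmx1 -scalemxAl.
by rewrite -psiE scalerA -rmorphM.
Qed.

End MeasureAndPrepare.

(** * The reverse test: [rho] and [sigma] as images of classical weights *)

Section ReverseTest.
Local Open Scope sesquilinear_scope.
Local Open Scope complex_scope.
Context {R : realType}.
Local Notation C := R[i].

Lemma adj_mxfun (f : R -> R) n (A : 'M[C]_n) :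
  A \is hermsymmx -> (mxfun f A) ^t* = mxfun f A.
Proof.
move=> /hermsymmx_diagonalizes[U [d Ud]]; rewrite (mxfun_diagonalizes f Ud).
by rewrite !adjmxM trmxCK adj_diag_op mulmxA.
Qed.

Lemma mxfunM (f g : R -> R) n (A : 'M[C]_n) :
  A \is hermsymmx -> mxfun f A *m mxfun g A = mxfun (fun x => f x * g x) A.
Proof.
move=> /hermsymmx_diagonalizes[U [d Ud]].
rewrite (mxfun_diagonalizes f Ud) (mxfun_diagonalizes g Ud).
rewrite (mxfun_diagonalizes (fun x => f x * g x) Ud) -diag_opM.
by rewrite !mulmxA (mulmxtVK _ Ud.1).
Qed.

Lemma eq_mxfun (f g : R -> R) n (A : 'M[C]_n) :
  psdmx A -> (forall x, 0 <= x -> f x = g x) -> mxfun f A = mxfun g A.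
Proof.
move=> /psdmx_diagonalizes[U [d [Ud d0]]] fg.
rewrite (mxfun_diagonalizes f Ud) (mxfun_diagonalizes g Ud).
by have /funext -> : (fun i => f (d i)) =1 (fun i => g (d i)) by move=> i; exact: fg.
Qed.

Lemma mxfun_id n (A : 'M[C]_n) : A \is hermsymmx -> mxfun id A = A.
Proof.
by move=> /hermsymmx_diagonalizes[U [d Ud]]; rewrite (mxfun_diagonalizes id Ud) [RHS]Ud.2.
Qed.

Lemma mxsqrtP n (A : 'M[C]_n) :
  psdmx A -> (mxsqrt A) ^t* = mxsqrt A /\ mxsqrt A *m mxsqrt A = A.
Proof.
move=> pA; split; first exact: adj_mxfun pA.1.
apply: (etrans (mxfunM _ _ pA.1)); rewrite -[RHS](mxfun_id pA.1).
by apply: (eq_mxfun pA) => x x0; rewrite -expr2 sqr_sqrtr.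
Qed.

(** The square root has its range inside that of [A], because sqrt x = x / sqrt x, at 0 as well
    since 0^-1 = 0. *)
Lemma mxsqrt_factor n (A : 'M[C]_n) : psdmx A -> exists Z, mxsqrt A = A *m Z.
Proof.
move=> pA; exists (mxfun (fun x => (Num.sqrt x)^-1) A).
rewrite -{2}(mxfun_id pA.1) (mxfunM _ _ pA.1).
apply: (eq_mxfun pA) => x x0.
have [->|x1] := eqVneq x 0; first by rewrite sqrtr0 mul0r.
by rewrite -{2}(sqr_sqrtr x0) expr2 mulfK // sqrtr_eq0 -ltNge lt_def x1.
Qed.

(** [B] is the generalized inverse square root; [mxsqrt A *m B] is the projection onto the support
    of [A]. *)
Lemma psdmx_sqrt_pinv n (A : 'M[C]_n) : psdmx A ->
  exists B : 'M[C]_n, [/\ B ^t* = B, B *m B = mxpinv A & mxsqrt A *m B *m A = A].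
Proof.
move=> pA; exists (mxfun (fun x => (Num.sqrt x)^-1) A); split.
- exact: adj_mxfun pA.1.
- apply: (etrans (mxfunM _ _ pA.1)); apply: (eq_mxfun pA) => x x0.
  by rewrite -invfM -expr2 sqr_sqrtr.
- rewrite -[X in _ *m X](mxfun_id pA.1) /mxsqrt !(mxfunM _ _ pA.1).
  rewrite -[RHS](mxfun_id pA.1).
  apply: (eq_mxfun pA) => x x0; have [->|x1] := eqVneq x 0; first by rewrite mulr0.
  by rewrite mulfV ?mul1r // sqrtr_eq0 -ltNge lt_def x1.
Qed.

Lemma reverse_test n (rho sigma : 'M[C]_n) :
  psdmx rho -> psdmx sigma -> supp_sub rho sigma ->
  exists (F : 'M[C]_n) (t : 'I_n -> R), [/\ F *m F ^t* = sigma,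
    F *m diag_op t *m F ^t* = rho, forall i, 0 <= t i &
    \tr (rho *m mxln (mxsqrt rho *m mxpinv sigma *m mxsqrt rho)) =
    \sum_i (ln (t i) * t i)%:C * (F ^t* *m F) i i].
Proof.
move=> pr ps /submxP[Y rhoT].
have {Y rhoT} [Y rhoE] : exists Y, rho = sigma *m Y.
  by exists Y^T; rewrite -[LHS]trmxK rhoT trmx_mul trmxK.
have [B [Ba BB SBsigma]] := psdmx_sqrt_pinv ps.
have [Sa SS] := mxsqrtP ps; have [Qa QQ] := mxsqrtP pr.
(* The support hypothesis enters here: the projection onto the support of [sigma] fixes [rho], hence
   also its square root. *)
have SBrho : mxsqrt sigma *m B *m rho = rho by rewrite rhoE mulmxA SBsigma.
have SBQ : mxsqrt sigma *m B *m mxsqrt rho = mxsqrt rho.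
  by have [Z ->] := mxsqrt_factor pr; rewrite mulmxA SBrho.
move: (mxsqrt sigma) (mxsqrt rho) Sa SS Qa QQ SBsigma SBrho SBQ.
move=> S Q Sa SS Qa QQ SBsigma SBrho SBQ.
pose X := B *m Q; pose T := B *m rho *m B.
have XaX : X ^t* *m X = Q *m mxpinv sigma *m Q.
  by rewrite /X adjmxM Ba Qa -BB !mulmxA.
have XXa : X *m X ^t* = T by rewrite /X /T adjmxM Ba Qa -QQ !mulmxA.
have pT : psdmx T by rewrite /T -{1}Ba; exact: psdmx_conj.
have hX : X ^t* *m X \is hermsymmx by apply/hermsymmxP; rewrite adjmxM trmxCK.
have XL : X *m mxln (X ^t* *m X) = mxln T *m X.
  by apply: (mxfun_intertwine _ hX pT.1); rewrite mulmxA XXa.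
have Q1 : Q = S *m X by rewrite /X mulmxA SBQ.
have Q2 : Q = X ^t* *m S by rewrite -Qa [in LHS]Q1 adjmxM Sa.
have STS : S *m T *m S = rho by rewrite -XXa mulmxA -Q1 -mulmxA -Q2.
clearbody X T.
have QLQ : Q *m mxln (X ^t* *m X) *m Q = S *m (mxln T *m T) *m S.
  rewrite [in X in X *m _ *m _]Q1 [in X in _ *m X]Q2 -(mulmxA S X) XL.
  by rewrite -XXa !mulmxA.
have [U [t [Ut t0]]] := psdmx_diagonalizes pT.
have lnTT : mxln T *m T = U ^t* *m diag_op (fun i => ln (t i) * t i) *m U.
  rewrite -[X in _ *m X](mxfun_id pT.1); apply: etrans (mxfunM _ _ pT.1) _.
  exact: mxfun_diagonalizes Ut.
exists (S *m U ^t*), t; rewrite adjmxM trmxCK Sa; split.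
- by rewrite mulmxA -(mulmxA S) (unitary_adjM Ut.1) mulmx1.
- by rewrite -STS [in RHS]Ut.2 !mulmxA.
- exact: t0.
(* With rho = Q Q, cyclicity of the trace puts one factor Q on each side of the logarithm, as [QLQ]
   requires. *)
rewrite -XaX -QQ -mulmxA mxtrace_mulC QLQ lnTT !mulmxA.
by rewrite -(mulmxA _ U S) mxtrace_mul_diag mulmxA.
Qed.

End ReverseTest.

(** * The upper bound, and the bound obtained from a measurement *)

Section DivergenceBounds.
Local Open Scope sesquilinear_scope.
Local Open Scope complex_scope.
Context {R : realType}.
Local Notation C := R[i].

Lemma diag_op1 n : diag_op (fun=> 1) = 1%:M :> 'M[C]_n.
Proof. by apply/matrixP => i j; rewrite !mxE. Qed.

Lemma psdmx1 n : psdmx (1%:M : 'M[C]_n).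
Proof. by rewrite -diag_op1; apply/psdmx_diag_op => i. Qed.

Lemma density_diag_op n (p : 'I_n -> R) : prob_dist p -> density (diag_op p).
Proof.
by move=> [p0 p1]; split; [exact/psdmx_diag_op | rewrite mxtrace_diag_op p1].
Qed.

Lemma psdmx_diag_real n (A : 'M[C]_n) : psdmx A ->
  exists p : 'I_n -> R, (forall i, A i i = (p i)%:C) /\ forall i, 0 <= p i.
Proof.
move=> pA; have AE i : A i i = (complex.Re (A i i))%:C.
  by rewrite Re_ge0K // psdmx_diag_ge0.
exists (fun i => complex.Re (A i i)); split=> // i.
by rewrite -(@ler0c R) -AE psdmx_diag_ge0.
Qed.

Lemma crelentE n (p q : 'I_n -> R) : (forall i, q i = 0 -> p i = 0) ->
  crelent p q = (\sum_i p i * (ln (p i) - ln (q i)))%:E.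
Proof.
move=> pq; rewrite /crelent ifT //; apply/forallP => i.
by apply/implyP => /eqP/pq ->.
Qed.

(** A single channel prepares both states from the distributions [p] and [q], so monotonicity and
    normalisation bound [DQ] by the classical relative entropy of [p] and [q]. *)
Lemma mono_le_qrelentR
  (DQ : forall n : nat, 'M[C]_n -> 'M[C]_n -> \bar R)
  (DQ_mono : forall (n m : nat) (L : {linear 'M[C]_n -> 'M[C]_m})
     (rho sigma : 'M[C]_n),
     cptp L -> density rho -> density sigma ->
     (DQ m (L rho) (L sigma) <= DQ n rho sigma)%E)
  (DQ_norm : forall (n : nat) (p q : 'I_n -> R),
     prob_dist p -> prob_dist q ->
     DQ n (diag_op p) (diag_op q) = crelent p q)
  n (rho sigma : 'M[C]_n) :
  density rho -> density sigma -> (DQ n rho sigma <= qrelentR rho sigma)%E.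
Proof.
move=> [pr tr] [ps ts]; rewrite /qrelentR; case: ifPn => [sup|_]; last exact: leey.
have [F [t [FF FtF t0 trE]]] := reverse_test pr ps sup.
have pFF : psdmx (F ^t* *m F).
  by rewrite -[X in psdmx (X *m _)]mulmx1; apply: psdmx_conj; exact: psdmx1.
have [q [Fq q0]] := psdmx_diag_real pFF.
have [L [cL LE]] := preparation Fq.
pose p i := t i * q i.
have Lq : L (diag_op q) = sigma.
  (* The case t = 1 of [LE], which yields F F^* = sigma. *)
  have -> : q = (fun i => 1 * q i) by apply/funext => i; rewrite mul1r.
  by rewrite LE diag_op1 mulmx1.
have Lp : L (diag_op p) = rho by rewrite LE.
have q1 : \sum_i q i = 1.
  apply: complexI; rewrite rmorph_sum rmorph1 -ts -FF mxtrace_mulC.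
  by apply: eq_bigr => i _; rewrite Fq.
have p1 : \sum_i p i = 1.
  apply: complexI; rewrite rmorph_sum rmorph1 -tr -FtF mxtrace_mul_diag.
  by apply: eq_bigr => i _; rewrite Fq -rmorphM.
have pp : prob_dist p by split=> // i; rewrite mulr_ge0.
have pq : prob_dist q by [].
rewrite -{1}Lp -{1}Lq.
apply: le_trans (DQ_mono _ _ _ _ _ cL (density_diag_op pp) (density_diag_op pq)) _.
rewrite DQ_norm // crelentE => [|i qi]; last by rewrite /p qi mulr0.
rewrite lee_fin trE.
under [in leRHS]eq_bigr do rewrite Fq -rmorphM.
rewrite -rmorph_sum /= le_eqVlt; apply/orP; left; apply/eqP; apply: eq_bigr => i _.
(* Terms with q_i = 0 or t_i = 0 vanish on both sides; otherwise ln(t_i q_i) - ln q_i = ln t_i. *)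
rewrite /p; have [->|qi] := eqVneq (q i) 0; first by rewrite !mulr0 mul0r.
have [->|ti] := eqVneq (t i) 0; first by rewrite !mulr0 !mul0r.
rewrite lnM ?posrE ?lt_def ?ti ?qi //=; ring.
Qed.

(** Both states undergo the same measurement in the basis [W], which turns them into the
    distributions on their diagonals. *)
Lemma crelent_le_mono
  (DQ : forall n : nat, 'M[C]_n -> 'M[C]_n -> \bar R)
  (DQ_mono : forall (n m : nat) (L : {linear 'M[C]_n -> 'M[C]_m})
     (rho sigma : 'M[C]_n),
     cptp L -> density rho -> density sigma ->
     (DQ m (L rho) (L sigma) <= DQ n rho sigma)%E)
  (DQ_norm : forall (n : nat) (p q : 'I_n -> R),
     prob_dist p -> prob_dist q ->
     DQ n (diag_op p) (diag_op q) = crelent p q)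
  n (rho sigma W : 'M[C]_n) (p q : 'I_n -> R) :
  density rho -> density sigma -> W \is unitarymx ->
  (forall l, (W *m rho *m W ^t*) l l = (p l)%:C) ->
  (forall l, (W *m sigma *m W ^t*) l l = (q l)%:C) ->
  (crelent p q <= DQ n rho sigma)%E.
Proof.
move=> dr ds uW Wp Wq; have [L [cL LE]] := measurement uW.
have prob (A : 'M[C]_n) (d : 'I_n -> R) : density A ->
    (forall l, (W *m A *m W ^t*) l l = (d l)%:C) ->
    prob_dist d /\ L A = diag_op d.
  move=> [pA tA] Wd; split; last first.
    rewrite LE /diag_op; suff -> : (\row_l (W *m A *m W ^t*) l l = \row_l (d l)%:C) by [].
    by apply/rowP => l; rewrite mxE Wd mxE.
  split=> [l|].
    rewrite -(@ler0c R) -Wd; apply: psdmx_diag_ge0.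
    by rewrite -{1}[W]trmxCK; exact: psdmx_conj.
  apply: complexI; rewrite rmorph_sum rmorph1 -tA.
  rewrite -[in RHS](mul1mx A) -(unitary_adjM uW) -mulmxA mxtrace_mulC.
  by apply: eq_bigr => l _; rewrite Wd.
have [pp Lr] := prob _ _ dr Wp; have [pq Ls] := prob _ _ ds Wq.
by rewrite -DQ_norm // -Lr -Ls; exact: DQ_mono.
Qed.

End DivergenceBounds.

(** * Entropy increase under a stochastic matrix *)

Section ClassicalEntropy.
Context {R : realType}.

(** The difference of the two entropy sums is the mean of ln(lam_j / p_l) under the weights lam_j
    N_jl. Apply ln x <= x - 1 to x = lam_j / (p_l v): by the last hypothesis the mean of x is at
    most 1, which leaves ln v. *)
Lemma sum_mixture_ln m n (lam : 'I_m -> R) (N : 'I_m -> 'I_n -> R)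
    (p : 'I_n -> R) (v : R) :
  (forall j, 0 <= lam j) -> (forall j l, 0 <= N j l) ->
  (forall j, \sum_l N j l = 1) -> \sum_j lam j = 1 ->
  (forall l, p l = \sum_j lam j * N j l) -> 0 < v ->
  \sum_l (\sum_j lam j ^+ 2 * N j l) / p l <= v ->
  \sum_j lam j * ln (lam j) <= \sum_l p l * ln (p l) + ln v.
Proof.
move=> lam0 N0 N1 lam1 pE v0 hv.
have term j l : lam j * N j l * (ln (lam j) - ln (p l)) <=
    lam j * N j l * (ln v - 1) + lam j ^+ 2 * N j l / p l / v.
  (* Terms of weight 0 are set apart; a positive weight forces p_l > 0, so that the logarithm of the
     quotient splits. *)
  have [lj|lj] := eqVneq (lam j) 0; first by rewrite lj expr0n !mul0r addr0.
  have [nj|nj] := eqVneq (N j l) 0; first by rewrite nj !(mulr0, mul0r) addr0.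
  have lp : 0 < lam j by rewrite lt_def lj lam0.
  have np : 0 < N j l by rewrite lt_def nj N0.
  have pp : 0 < p l.
    rewrite pE (bigD1 j) //=; apply: ltr_pwDl; first exact: mulr_gt0.
    by apply: sumr_ge0 => i _; exact: mulr_ge0.
  have x0 : 0 < lam j / p l / v by rewrite !divr_gt0.
  have := @le_ln1Dx R (lam j / p l / v - 1).
  rewrite -subr_gt0 opprK subrK => /(_ x0); rewrite subrKC.
  rewrite !ln_div ?posrE ?divr_gt0 // => hx.
  have : lam j * N j l * (ln (lam j) - ln (p l) - ln v) <=
      lam j * N j l * (lam j / p l / v - 1).
    by rewrite ler_pM2l // mulr_gt0.
  have -> : lam j ^+ 2 * N j l / p l / v = lam j * N j l * (lam j / p l / v).
    by rewrite expr2; ring.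
  lra.
have : \sum_j \sum_l lam j * N j l * (ln (lam j) - ln (p l)) <=
    \sum_j \sum_l (lam j * N j l * (ln v - 1) + lam j ^+ 2 * N j l / p l / v).
  by apply: ler_sum => j _; apply: ler_sum => l _; exact: term.
have -> : \sum_j \sum_l lam j * N j l * (ln (lam j) - ln (p l)) =
    \sum_j lam j * ln (lam j) - \sum_l p l * ln (p l).
  have -> : \sum_l p l * ln (p l) = \sum_j \sum_l lam j * N j l * ln (p l).
    by rewrite exchange_big; apply: eq_bigr => l _ /=; rewrite {1}pE mulr_suml.
  rewrite -sumrB; apply: eq_bigr => j _.
  have -> : lam j * ln (lam j) = \sum_l lam j * N j l * ln (lam j).
    by rewrite -mulr_suml -mulr_sumr N1 mulr1.
  by rewrite -sumrB; apply: eq_bigr => l _; rewrite mulrBr.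
have -> : \sum_j \sum_l
    (lam j * N j l * (ln v - 1) + lam j ^+ 2 * N j l / p l / v) =
    ln v - 1 + (\sum_l (\sum_j lam j ^+ 2 * N j l) / p l) / v.
  under eq_bigr do rewrite big_split /=.
  rewrite big_split /=; congr (_ + _).
    under eq_bigr do rewrite -mulr_suml -mulr_sumr N1 mulr1.
    by rewrite -mulr_suml lam1 mul1r.
  rewrite exchange_big mulr_suml; apply: eq_bigr => l _ /=.
  by rewrite !mulr_suml.
have : (\sum_l (\sum_j lam j ^+ 2 * N j l) / p l) / v <= 1.
  by rewrite ler_pdivrMr // mul1r.
lra.
Qed.

End ClassicalEntropy.

(** * Schur complements and the pinching inequality *)

Section Pinching.
Local Open Scope sesquilinear_scope.
Local Open Scope complex_scope.
Context {R : realType}.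
Local Notation C := R[i].

(* The Schur complement of the diagonal block b, seen from index k: evaluate
   the form at e_k - sum_(l in b) (A_lk / A_ll) e_l. *)
Lemma psdmx_schur n (T : eqType) (A : 'M[C]_n) (c : 'I_n -> T) k b :
  psdmx A -> (forall i j, i != j -> c i = c j -> A i j = 0) ->
  \sum_(l | c l == b) A k l * A l k / A l l <= A k k.
Proof.
move=> pA cA; have [hA posA] := pA.
have Aconj i j : (A i j)^*%R = A j i.
  by have /hermsymmxP/matrixP/(_ j i) := hA; rewrite !mxE.
pose y : 'cV[C]_n := \col_l (if c l == b then A l k / A l l else 0).
pose e : 'cV[C]_n := delta_mx k 0.
set s := (X in X <= _).
have AeE i : (A *m e) i 0 = A i k by rewrite -colE mxE.
have eAE (z : 'cV[C]_n) : (e ^t* *m A *m z) 0 0 = (A *m z) k 0.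
  by rewrite trmx_delta map_delta_mx -mulmxA -rowE mxE.
have yE l : y l 0 = if c l == b then A l k / A l l else 0 by rewrite mxE.
have yAE (z : 'cV[C]_n) :
    (y ^t* *m A *m z) 0 0 = \sum_l (y l 0)^*%R * (A *m z) l 0.
  by rewrite -mulmxA mxE; apply: eq_bigr => l _; rewrite 2!mxE.
have yAe : (y ^t* *m A *m e) 0 0 = s.
  rewrite yAE /s [RHS]big_mkcond; apply: eq_bigr => l _.
  rewrite AeE yE; case: ifP => _; last by rewrite conjC0 mul0r.
  by rewrite fmorph_div /= !Aconj mulrAC.
have eAy : (e ^t* *m A *m y) 0 0 = s.
  rewrite eAE mxE /s [RHS]big_mkcond; apply: eq_bigr => l _.
  by rewrite yE; case: ifP => _; rewrite ?mulr0 // mulrA.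
have yAy : (y ^t* *m A *m y) 0 0 = s.
  rewrite -yAe !yAE; apply: eq_bigr => l _.
  rewrite AeE yE; case: ifPn => [/eqP cl|_]; last by rewrite conjC0 !mul0r.
  (* If A_ll = 0, then y_l = 0 because 0^-1 = 0. Otherwise, [A] being diagonal inside the block, (A
     y)_l = A_ll y_l = A_lk. *)
  have [Al|Al] := eqVneq (A l l) 0.
    by rewrite Al invr0 mulr0 conjC0 !mul0r.
  suff -> : (A *m y) l 0 = A l k by [].
  rewrite mxE (bigD1 l) //= big1 ?addr0 => [|j jl].
    by rewrite yE cl eqxx mulrC divfK.
  rewrite yE; case: ifP => [/eqP cj|_]; last by rewrite mulr0.
  by rewrite cA ?mul0r // 1?eq_sym // cl cj.
have eAe : (e ^t* *m A *m e) 0 0 = A k k by rewrite eAE AeE.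
(* The form at e - y expands to A_kk - s - (s - s). *)
clearbody e y; have := posA (e - y).
have subE (X Y : 'M[C]_1) : (X - Y) 0 0 = X 0 0 - Y 0 0 by rewrite !mxE.
have -> : (e - y) ^t* = e ^t* - y ^t*.
  by apply/matrixP => i j; rewrite !mxE rmorphB.
rewrite (mulmxBl _ (y ^t*) A) (mulmxBl _ (y ^t* *m A)) subE.
rewrite (mulmxBr _ e y) subE (mulmxBr _ e y) subE.
by rewrite eAe eAy yAe yAy subrr subr0 subr_ge0.
Qed.

(** For a fixed index k each of the blocks contributes at most A_kk by [psdmx_schur]; summing over
    blocks and then over k gives the bound. Since [A] is diagonal inside every block, its pinching
    is its diagonal, and the left side is tr (A^2 B^-1). *)
Lemma psdmx_pinching n (T : finType) (A : 'M[C]_n) (c : 'I_n -> T) :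
  psdmx A -> (forall i j, i != j -> c i = c j -> A i j = 0) ->
  \sum_l (A *m A) l l / A l l <= #|T|%:R * \tr A.
Proof.
move=> pA cA; rewrite mulr_sumr.
have -> : \sum_l (A *m A) l l / A l l =
    \sum_k \sum_b \sum_(l | c l == b) A k l * A l k / A l l.
  under [RHS]eq_bigr => k _.
    have <- : \sum_l A k l * A l k / A l l =
        \sum_b \sum_(l | c l == b) A k l * A l k / A l l.
      exact: (partition_big c predT).
    over.
  rewrite exchange_big; apply: eq_bigr => l _ /=.
  by rewrite mxE mulr_suml; apply: eq_bigr => k _; rewrite [A l k * _]mulrC.
apply: ler_sum => k _; rewrite mulr_natl -sumr_const.
by apply: ler_sum => b _; exact: psdmx_schur.
Qed.

End Pinching.

(** * A basis adapted to two Hermitian matrices *)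

Section BlockDiagonalization.
Local Open Scope sesquilinear_scope.

(* The matrix D + iE is normal, and its spectral decomposition diagonalises its
   hermitian part D and its skew-hermitian part iE. *)
Lemma hermitian_codiagonalization (C : numClosedFieldType) n (D E : 'M[C]_n) :
  D \is hermsymmx -> E \is hermsymmx -> D *m E = E *m D ->
  exists2 P : 'M[C]_n, P \is unitarymx & forall i j, i != j ->
    (P *m D *m P ^t*) i j = 0 /\ (P *m E *m P ^t*) i j = 0.
Proof.
move=> /hermsymmxP hD /hermsymmxP hE DE.
pose N := D + 'i *: E.
have Nadj : N ^t* = D - 'i *: E.
  by rewrite /N adjmxD adjmxZ conjCi scaleNr hD hE.
have nN : N \is normalmx.
  apply/normalmxP; rewrite Nadj /N.
  have : D *m ('i *: E) = 'i *: E *m D by rewrite -scalemxAr -scalemxAl DE.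
  move: ('i *: E) => F DF.
  rewrite !(mulmxDl, mulmxDr, mulmxN, mulNmx) DF -!addrA.
  by rewrite [in LHS](addrCA (- _)).
have /orthomx_spectralP := nN; set P := spectralmx N; set d := spectral_diag N.
move=> NE; have uP : P \is unitarymx := spectral_unitarymx N; exists P => // i j ij.
have PNP : P *m N *m P ^t* = diag_mx d.
  rewrite [in LHS]NE invmx_unitary // !mulmxA (unitarymxP uP) mul1mx.
  by rewrite -mulmxA (unitarymxP uP) mulmx1.
have PNaP : P *m N ^t* *m P ^t* = (diag_mx d) ^t*.
  by rewrite -PNP !adjmxM trmxCK mulmxA.
have e1 : (P *m D *m P ^t*) i j + 'i * (P *m E *m P ^t*) i j = 0.
  have /matrixP/(_ i j) := PNP.
  rewrite /N mulmxDr mulmxDl -scalemxAr -scalemxAl mxE [X in _ + X]mxE => ->.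
  by rewrite mxE (negPf ij).
have e2 : (P *m D *m P ^t*) i j - 'i * (P *m E *m P ^t*) i j = 0.
  have /matrixP/(_ i j) := PNaP; rewrite Nadj.
  rewrite mulmxBr mulmxBl -scalemxAr -scalemxAl mxE.
  rewrite [X in _ + X]mxE [X in - X]mxE => ->.
  by rewrite !mxE eq_sym (negPf ij) conjC0.
(* The off-diagonal entries x + iy of N and x - iy of its adjoint both vanish, so x and y do. *)
move: e1 e2; set x := (_ *m D *m _) i j; set y := (_ *m E *m _) i j => e1 e2.
have x0 : x = 0.
  have : x *+ 2 = 0 by rewrite mulr2n -[RHS](addr0 0) -{1}e1 -e2; ring.
  by move/eqP; rewrite mulrn_eq0 => /eqP.
split=> //; move/eqP: e1; rewrite x0 add0r mulf_eq0 => /orP[|/eqP//].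
by rewrite (negPf (neq0Ci C)).
Qed.

Local Open Scope complex_scope.
Context {R : realType}.
Local Notation C := R[i].

(** The pinching [E] of [A] to the eigenspaces of [diag_op s] commutes with [diag_op s], and [V]
    diagonalises both. Each row of [V] lives in one eigenspace, named by an index [k i] with
    eigenvalue [s (k i)]. *)
Lemma pinched_basis n (A : 'M[C]_n) (s : 'I_n -> R) : A \is hermsymmx ->
  exists (V : 'M[C]_n) (k : 'I_n -> 'I_n), [/\ V \is unitarymx,
    (forall i j, V i j != 0 -> s j = s (k i)) &
    forall i j, i != j -> s (k i) = s (k j) -> (V *m A *m V ^t*) i j = 0].
Proof.
move=> hA; pose E : 'M[C]_n := \matrix_(i, j) (if s i == s j then A i j else 0).
have hD : diag_op s \is hermsymmx by apply/hermsymmxP; exact: adj_diag_op.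
have Aconj i j : (A i j)^*%R = A j i.
  by have /hermsymmxP/matrixP/(_ j i) := hA; rewrite !mxE.
have hE : E \is hermsymmx.
  apply/hermsymmxP/matrixP => i j; rewrite !mxE eq_sym.
  by case: ifP => _; [exact: Aconj | exact: conjC0].
have DE : diag_op s *m E = E *m diag_op s.
  apply/matrixP => i j; rewrite (mul_diag_opE s E) (mul_mx_diag_opE s E) !mxE.
  by case: eqP => [->|_]; rewrite ?mulr0 ?mul0r // mulrC.
have [V uV VDE] := hermitian_codiagonalization hD hE DE.
pose d i := (V *m diag_op s *m V ^t*) i i.
have VD i j : V i j * (s j)%:C = d i * V i j.
  have E1 : V *m diag_op s *m V ^t* = diag_mx (\row_i d i).
    apply/matrixP => a b; rewrite [RHS]mxE [X in _ = X *+ _]mxE.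
    by case: eqVneq => [->|/VDE[-> _]]; rewrite ?mulr1n ?mulr0n.
  have := congr1 (fun X => (X *m V) i j) E1.
  rewrite -(mulmxA (V *m _)) (unitary_adjM uV) mulmx1 (mul_mx_diag_opE s V) => ->.
  by rewrite mul_diag_mx !mxE.
(* A row of a unitary matrix has norm 1, hence a nonzero entry; its column represents the eigenvalue
   of the row. *)
have /fin_all_exists[k kP] i : exists k, V i k != 0.
  apply/existsP; rewrite -[X in is_true X]negbK; apply/negP => /existsPn V0.
  have /eqP := unitary_row_sqr i uV; rewrite big1 ?(eq_sym 0) ?oner_eq0 // => j _.
  by have /negPn/eqP -> := V0 j; rewrite normr0 expr0n.
have dE i : d i = (s (k i))%:C.
  by apply: (mulIf (kP i)); rewrite -VD mulrC.
have sk i j : V i j != 0 -> s j = s (k i).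
  move=> Vij; apply: complexI; rewrite -dE; apply: (mulIf Vij).
  by rewrite -VD mulrC.
exists V, k; split=> // i j ij kij.
have [_ <-] := VDE i j ij.
(* Rows i and j are supported on indices of one common eigenvalue, where the entries of [A] and [E]
   coincide. *)
rewrite mxE [RHS]mxE; apply: eq_bigr => b _.
rewrite (adjmxE V); have [->|Vjb] := eqVneq (V j b) 0.
  by rewrite conjC0 !mulr0.
suff -> : (V *m A) i b = (V *m E) i b by [].
rewrite mxE [RHS]mxE; apply: eq_bigr => a _.
have [->|Via] := eqVneq (V i a) 0; first by rewrite !mul0r.
by rewrite [E a b]mxE (sk _ _ Via) (sk _ _ Vjb) kij eqxx.
Qed.


End BlockDiagonalization.

(** * The single-copy lower bound with its logarithmic loss *)

Section PinchingBound.
Local Open Scope sesquilinear_scope.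
Local Open Scope complex_scope.
Context {R : realType}.
Local Notation C := R[i].

Lemma conj_diag_op_diag n (Z : 'M[C]_n) (d : 'I_n -> R) l :
  (Z ^t* *m diag_op d *m Z) l l = \sum_j (d j)%:C * `|Z j l| ^+ 2.
Proof.
rewrite -mulmxA mxE; apply: eq_bigr => j _.
by rewrite (adjmxE Z) (mul_diag_opE d Z) normCK mulrCA [_^*%R * _]mulrC.
Qed.

Lemma mxtrace_mul_diag_op n (A : 'M[C]_n) (d : 'I_n -> R) :
  \tr (A *m diag_op d) = \sum_i A i i * (d i)%:C.
Proof. by apply: eq_bigr => i _; exact: mul_mx_diag_opE. Qed.

(** Measure in the basis Y = V U, where [sigma] is diagonal and [rho] is diagonal inside each
    eigenspace of [sigma]. The term tr rho ln sigma survives unchanged; only the entropy term loses,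
    by at most the logarithm of the number of labels. *)
Lemma pinching_bound
  (DQ : forall n : nat, 'M[C]_n -> 'M[C]_n -> \bar R)
  (DQ_mono : forall (n m : nat) (L : {linear 'M[C]_n -> 'M[C]_m})
     (rho sigma : 'M[C]_n),
     cptp L -> density rho -> density sigma ->
     (DQ m (L rho) (L sigma) <= DQ n rho sigma)%E)
  (DQ_norm : forall (n : nat) (p q : 'I_n -> R),
     prob_dist p -> prob_dist q ->
     DQ n (diag_op p) (diag_op q) = crelent p q)
  n (rho sigma U W : 'M[C]_n) (s lam p0 : 'I_n -> R)
  (T : finType) (c : 'I_n -> T) (g : T -> R) :
  density rho -> density sigma ->
  diagonalizes U s sigma -> diagonalizes W lam rho -> (forall j, 0 <= lam j) ->
  (forall j, (U *m rho *m U ^t*) j j = (p0 j)%:C) ->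
  (forall j, s j = g (c j)) ->
  ((\sum_j lam j * ln (lam j) - \sum_j p0 j * ln (s j) - ln #|T|%:R)%:E
     <= DQ n rho sigma)%E.
Proof.
move=> dr ds Us Wl lam0 Up sc.
have lam1 : \sum_j lam j = 1.
  by apply: complexI; rewrite -(diagonalizes_tr Wl) dr.2.
have pA : psdmx (U *m rho *m U ^t*).
  by rewrite -{1}[U]trmxCK; exact: psdmx_conj dr.1.
have [V [k [uV Vs Vblk]]] := pinched_basis s pA.1.
pose Y := V *m U; have uY : Y \is unitarymx := mul_unitarymx uV Us.1.
have YE (X : 'M[C]_n) : V *m (U *m X *m U ^t*) *m V ^t* = Y *m X *m Y ^t*.
  by rewrite adjmxM !mulmxA.
clearbody Y.
have inter (f : R -> R) : V *m diag_op (fun j => f (s j)) =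
    diag_op (fun l => f (s (k l))) *m V.
  apply/matrixP => l j; rewrite (mul_mx_diag_opE _ V) (mul_diag_opE _ V).
  have [->|Vlj] := eqVneq (V l j) 0; first by rewrite mulr0 mul0r.
  by rewrite (Vs _ _ Vlj) mulrC.
have Ysig : Y *m sigma *m Y ^t* = diag_op (fun l => s (k l)).
  rewrite -YE (diagonalizes_conj Us) (inter id) -mulmxA.
  by rewrite (unitarymxP uV) mulmx1.
have pA' : psdmx (Y *m rho *m Y ^t*).
  by rewrite -{1}[Y]trmxCK; exact: psdmx_conj dr.1.
have [p [pE p_ge0]] := psdmx_diag_real pA'.
have sE l : (Y *m sigma *m Y ^t*) l l = (s (k l))%:C by rewrite Ysig diag_op_diag.
apply: le_trans (crelent_le_mono DQ_mono DQ_norm dr ds uY pE sE).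
rewrite /crelent; case: ifP => _; last exact: leey.
rewrite lee_fin.
(* Both sides are tr rho ln sigma, computed in two eigenbases of [sigma]. *)
have lnsE : \sum_l p l * ln (s (k l)) = \sum_j p0 j * ln (s j).
  apply: complexI; rewrite !rmorph_sum /=.
  transitivity (\tr (Y *m rho *m Y ^t* *m diag_op (fun l => ln (s (k l))))).
    by rewrite mxtrace_mul_diag_op; apply: eq_bigr => l _; rewrite pE rmorphM.
  rewrite -YE mxtrace_mulC; move: (U *m rho *m U ^t*) Up => A Up.
  rewrite !mulmxA -(inter (@ln R)) -!mulmxA mxtrace_mulC.
  rewrite -!mulmxA (unitary_adjM uV) mulmx1 mxtrace_mulC mxtrace_mul_diag_op.
  by apply: eq_bigr => j _; rewrite Up rmorphM.
have -> : \sum_l p l * (ln (p l) - ln (s (k l))) =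
    \sum_l p l * ln (p l) - \sum_j p0 j * ln (s j).
  by rewrite -lnsE -sumrB; apply: eq_bigr => l _; rewrite mulrBr.
pose Z := W *m Y ^t*.
have uZ : Z \is unitarymx.
  by apply: (mul_unitarymx Wl.1); rewrite trmxC_unitary.
have rhoE : Y *m rho *m Y ^t* = Z ^t* *m diag_op lam *m Z.
  by rewrite /Z (adjmxM W) trmxCK [in LHS]Wl.2 !mulmxA.
clearbody Z.
(* The squared moduli of the change of basis from eigenvectors of [rho] to the measured basis form
   the stochastic matrix that sends [lam] to [p]. *)
pose N j l := (complex.Re (Z j l)) ^+ 2 + (complex.Im (Z j l)) ^+ 2.
have NE j l : (N j l)%:C = `|Z j l| ^+ 2 by rewrite add_Re2_Im2.
have pN l : p l = \sum_j lam j * N j l.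
  apply: complexI; rewrite -pE rhoE conj_diag_op_diag rmorph_sum.
  by apply: eq_bigr => j _; rewrite -NE rmorphM.
have p2N l : ((Y *m rho *m Y ^t*) *m (Y *m rho *m Y ^t*)) l l =
    (\sum_j lam j ^+ 2 * N j l)%:C.
  have -> : (Y *m rho *m Y ^t*) *m (Y *m rho *m Y ^t*) =
      Z ^t* *m diag_op (fun j => lam j * lam j) *m Z.
    by rewrite rhoE -diag_opM !mulmxA (mulmxtVK _ uZ).
  rewrite conj_diag_op_diag rmorph_sum.
  by apply: eq_bigr => j _; rewrite -NE -expr2 [RHS]rmorphM.
(* Dimension 0 is excluded because [lam] sums to 1, so some index supplies a label. *)
have T0 : 0 < #|T|%:R :> R.
  rewrite ltr0n; apply/card_gt0P.
  have [j _|n0] := pickP (fun _ : 'I_n => true); first by exists (c j).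
  by move/eqP: lam1; rewrite big_pred0 // eq_sym oner_eq0.
rewrite lerBlDr addrAC lerD2r.
apply: (@sum_mixture_ln _ _ _ lam N p) => //.
- by move=> j l; rewrite addr_ge0 ?sqr_ge0.
- move=> j; apply: complexI; rewrite rmorph_sum rmorph1 -(unitary_row_sqr j uZ).
  by apply: eq_bigr => l _; exact: NE.
(* This supplies the last hypothesis of [sum_mixture_ln], the trace being 1. Equal labels force
   equal eigenvalues of [sigma], so the rotated [rho] is diagonal inside each label class. *)
have := psdmx_pinching (c := fun l => c (k l)) pA'.
have trY : \tr (Y *m rho *m Y ^t*) = 1.
  by rewrite rhoE (diagonalizes_tr (conj uZ erefl)) lam1 rmorph1.
rewrite trY mulr1 -lecR rmorph_sum => pinch.
have -> : (#|T|%:R : R)%:C = #|T|%:R by rewrite rmorph_nat.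
under eq_bigr do rewrite fmorph_div /= -p2N -pE.
by apply: pinch => i j ij cij; rewrite -YE; apply: Vblk => //; rewrite !sc cij.
Qed.

End PinchingBound.

(** * Spectral data of tensor powers and the growth of the logarithm *)

Section TensorPowers.
Local Open Scope sesquilinear_scope.
Local Open Scope complex_scope.
Context {R : realType}.
Local Notation C := R[i].

Definition tensf m n (f : 'I_m -> R) (g : 'I_n -> R) (i : 'I_(m * n)) : R :=
  f (mxtens_unindex i).1 * g (mxtens_unindex i).2.

Lemma sum_tens m n (F : 'I_m -> 'I_n -> R) :
  \sum_i F (mxtens_unindex i).1 (mxtens_unindex i).2 = \sum_i \sum_j F i j.
Proof.
rewrite (reindex (@mxtens_index m n)); last first.
  exists (@mxtens_unindex m n) => i _; first exact: mxtens_indexK.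
  exact: mxtens_unindexK.
by rewrite pair_bigA; apply: eq_bigr => -[i j] _; rewrite mxtens_indexK.
Qed.

(** Absolute continuity of [p] with respect to the weights [s], which neutralises ln 0 = 0. With
    both arguments equal it just says that they form a distribution. *)
Definition dominated n (p s : 'I_n -> R) :=
  [/\ prob_dist p, forall j, 0 <= s j & forall j, s j = 0 -> p j = 0].

Lemma dominated_tens m n (p s : 'I_m -> R) (q t : 'I_n -> R) :
  dominated p s -> dominated q t -> dominated (tensf p q) (tensf s t).
Proof.
move=> [[p0 p1] s0 ps] [[q0 q1] t0 qt]; split.
- split=> [i|]; first exact: mulr_ge0.
  rewrite (sum_tens (fun i j => p i * q j)) -[RHS]mulr1 -{1}p1 -q1 mulr_suml.
  by apply: eq_bigr => i _; rewrite mulr_sumr.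
- by move=> j; exact: mulr_ge0.
- move=> j /eqP; rewrite mulf_eq0 /tensf => /orP[/eqP/ps|/eqP/qt] ->.
    by rewrite mul0r.
  by rewrite mulr0.
Qed.

Lemma sum_ln_tens m n (p s : 'I_m -> R) (q t : 'I_n -> R) :
  dominated p s -> dominated q t ->
  \sum_i tensf p q i * ln (tensf s t i) =
  \sum_i p i * ln (s i) + \sum_j q j * ln (t j).
Proof.
move=> [[p0 p1] s0 ps] [[q0 q1] t0 qt].
rewrite (sum_tens (fun i j => p i * q j * ln (s i * t j))).
transitivity (\sum_i \sum_j (p i * ln (s i) * q j + p i * (q j * ln (t j)))).
  apply: eq_bigr => i _; apply: eq_bigr => j _.
  (* ln(s_i t_j) does not split when a factor is 0, but domination then makes the weight 0. *)
  have [/ps->|si] := eqVneq (s i) 0; first by rewrite !mul0r addr0.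
  have [/qt->|tj] := eqVneq (t j) 0; first by rewrite !(mulr0, mul0r) addr0.
  by rewrite lnM ?posrE ?lt_def ?si ?tj //=; ring.
under eq_bigr do rewrite big_split /= -!mulr_sumr q1 mulr1.
by rewrite big_split /= -mulr_suml p1 mul1r.
Qed.

(** The data that [pinching_bound] consumes, in a form stable under tensor products; [p] is the
    diagonal of [rho] in the eigenbasis of [sigma], so that tr rho ln sigma is the sum of p_j ln
    s_j. *)
Record joint_spectrum n (rho sigma U W : 'M[C]_n) (s lam p : 'I_n -> R) : Prop :=
  JointSpectrum {
    joint_sigma : diagonalizes U s sigma;
    joint_rho : diagonalizes W lam rho;
    joint_diag : forall j, (U *m rho *m U ^t*) j j = (p j)%:C;
    joint_lam : dominated lam lam;
    joint_p : dominated p s }.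

Lemma joint_spectrum_tens m n (rho sigma U W : 'M[C]_m) s lam p
    (rho' sigma' U' W' : 'M[C]_n) s' lam' p' :
  joint_spectrum rho sigma U W s lam p ->
  joint_spectrum rho' sigma' U' W' s' lam' p' ->
  joint_spectrum (rho *t rho') (sigma *t sigma') (U *t U') (W *t W')
    (tensf s s') (tensf lam lam') (tensf p p').
Proof.
move=> [Us Wl Up dl dp] [Us' Wl' Up' dl' dp']; split.
- exact: diagonalizes_tens.
- exact: diagonalizes_tens.
- move=> j; rewrite adj_tensmx !tensmx_mul.
  case: (mxtens_indexP j) => [j1 j2].
  by rewrite tensmxE Up Up' /tensf mxtens_indexK rmorphM.
- exact: dominated_tens.
- exact: dominated_tens.
Qed.

Lemma density_ntensmx n (A : 'M[C]_n) k : density A -> density (ntensmx A k.+1).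
Proof.
move=> dA; elim: k => [//|k IHk]; rewrite ntensmxSS; exact: density_tens.
Qed.

(* The exponents c j x count the occurrences of the eigenvalue index x in the
   multi-index j, so that s' has at most (k + 2) ^ n values. *)
Lemma joint_spectrum_ntensmx n (rho sigma U W : 'M[C]_n) s lam p k :
  joint_spectrum rho sigma U W s lam p ->
  exists (U' W' : 'M[C]_(n ^ k.+1)) s' lam' p'
    (c : 'I_(n ^ k.+1) -> 'I_n -> nat),
    [/\ joint_spectrum (ntensmx rho k.+1) (ntensmx sigma k.+1) U' W' s' lam' p',
        forall j, s' j = \prod_x s x ^+ c j x, forall j x, (c j x <= k.+1)%N,
        \sum_j lam' j * ln (lam' j) = k.+1%:R * \sum_j lam j * ln (lam j) &
        \sum_j p' j * ln (s' j) = k.+1%:R * \sum_j p j * ln (s j)].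
Proof.
move=> J; elim: k => [|k [U' [W' [s' [lam' [p' [c [J' s'E cE lamE pE]]]]]]]].
  exists U, W, s, lam, p, (fun j x => (x == j) : nat); split=> //.
  - move=> j; rewrite (bigD1 j) //= eqxx expr1 big1 ?mulr1 // => x /negPf ->.
    by rewrite expr0.
  - by move=> j x; exact: leq_b1.
  - by rewrite mul1r.
  - by rewrite mul1r.
exists (U *t U'), (W *t W'), (tensf s s'), (tensf lam lam'), (tensf p p').
exists (fun j x => (x == (mxtens_unindex j).1) + c (mxtens_unindex j).2 x)%N.
split.
- exact: joint_spectrum_tens.
- move=> j; rewrite /tensf s'E.
  under [RHS]eq_bigr do rewrite exprD.
  rewrite big_split; congr (_ * _); set a := (mxtens_unindex j).1.
  rewrite (bigD1 a) //= eqxx expr1 big1 ?mulr1 // => x /negPf ->.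
  by rewrite expr0.
- by move=> j x; exact: (leq_add (leq_b1 _) (cE _ x)).
- rewrite sum_ln_tens; [|exact: joint_lam J|exact: joint_lam J'].
  by rewrite lamE -[k.+2]addn1 natrD mulrDl mul1r addrC.
- rewrite sum_ln_tens; [|exact: joint_p J|exact: joint_p J'].
  by rewrite pE -[k.+2]addn1 natrD mulrDl mul1r addrC.
Qed.

(** A positive slope overtakes every multiple of the logarithm. The bound ln y < y alone is too
    weak; applied to the square root of k + 2 it gives growth of order sqrt k. *)
Lemma le0_of_ln_growth (a x : R) :
  0 <= a -> (forall k : nat, k.+1%:R * x <= a * ln k.+2%:R) -> x <= 0.
Proof.
move=> a0 hx; rewrite leNgt; apply/negP => x0.
pose m := Num.bound (2 * a / x); pose M : R := m%:R + 1.
have mx : 2 * a < M * x.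
  rewrite -ltr_pdivrMr //; apply: lt_trans (archi_boundP _) _.
    by rewrite divr_ge0 ?mulr_ge0 // ltW.
  by rewrite /M ltrDl.
have M0 : 0 < M by rewrite /M ltr_wpDl.
(* The choice of k makes k + 2 a square, (M + 1) ^ 2. *)
have k1 : (m * (m + 4) + 2).+1%:R = M * (M + 2).
  by rewrite -addn1 !natrD natrM natrD /M; ring.
have k2 : (m * (m + 4) + 2).+2%:R = (M + 1) ^+ 2.
  by rewrite -addn2 !natrD natrM natrD /M; ring.
have := hx (m * (m + 4) + 2)%N; rewrite k1 k2.
rewrite lnXn ?addr_gt0 // => h.
have lnM1 : ln (M + 1) < M + 1 by rewrite ln_sublinear ?addr_gt0.
have h1 : a * ln (M + 1) <= a * (M + 1) by rewrite ler_wpM2l // ltW.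
have h2 : 2 * a * (M + 2) < M * x * (M + 2) by rewrite ltr_pM2r // addr_gt0.
(* The contradiction is M (M + 2) x <= 2 a ln(M + 1) <= 2 a (M + 1) <= 2 a (M + 2) < M x (M + 2). *)
move: h; rewrite -mulr_natr; nra.
Qed.

End TensorPowers.

(** * Supports, and the lower bound through many copies *)

Section LowerBound.
Local Open Scope sesquilinear_scope.
Local Open Scope complex_scope.
Context {R : realType}.
Local Notation C := R[i].

(** For A = S S^* the entry A_ii is the squared norm of row i of S, and A_ij is the inner product of
    rows i and j. *)
Lemma psdmx_row0 n (A : 'M[C]_n) i j : psdmx A -> A i i = 0 -> A i j = 0.
Proof.
move=> pA; have [Sa SS] := mxsqrtP pA; move: (mxsqrt A) Sa SS => S Sa SS.
have AE a b : A a b = \sum_k S a k * (S b k)^*%R.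
  rewrite -SS -[in X in (_ *m X) a b]Sa mxE; apply: eq_bigr => k _.
  by rewrite (adjmxE S).
rewrite AE => /eqP; rewrite psumr_eq0 => [/allP S0|k _]; last exact: mul_conjC_ge0.
rewrite AE big1 // => k _; have := S0 k; rewrite mem_index_enum mul_conjC_eq0.
by move=> /(_ isT)/eqP ->; rewrite mul0r.
Qed.

Lemma supp_subP n (rho sigma U : 'M[C]_n) (s p : 'I_n -> R) :
  psdmx rho -> diagonalizes U s sigma ->
  (forall j, (U *m rho *m U ^t*) j j = (p j)%:C) ->
  reflect (forall j, s j = 0 -> p j = 0) (supp_sub rho sigma).
Proof.
move=> pr Us Up; have /unitarymxP UU := Us.1.
have pA : psdmx (U *m rho *m U ^t*).
  by rewrite -{1}[U]trmxCK; exact: psdmx_conj.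
apply: (iffP submxP) => [[Y rhoT] j sj|sp].
  have rhoE : rho = sigma *m Y^T by rewrite -[LHS]trmxK rhoT trmx_mul trmxK.
  apply: complexI; rewrite -Up rhoE {1}Us.2 !mulmxA UU mul1mx -!mulmxA.
  by rewrite mul_diag_opE sj mul0r.
have rhoE : rho = U ^t* *m (U *m rho *m U ^t*) *m U.
  rewrite -!mulmxA (unitary_adjM Us.1) mulmx1 mulmxA (unitary_adjM Us.1).
  by rewrite mul1mx.
move: pA Up rhoE; move: (U *m rho *m U ^t*) => A pA Ap rhoE.
have [D AE] : exists D : 'M[C]_n, A = diag_op s *m (D *m A).
  (* As 0^-1 = 0, the product with [diag_op s] projects onto the indices with s_i nonzero; the
     remaining rows of [A] vanish by [psdmx_row0]. *)
  exists (diag_op (fun j => (s j)^-1)).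
  apply/matrixP => i j; rewrite mulmxA diag_opM (mul_diag_opE _ A).
  have [si|si] := eqVneq (s i) 0; last by rewrite mulfV // rmorph1 mul1r.
  by rewrite (psdmx_row0 _ pA) ?mulr0 // Ap sp.
exists (U ^t* *m (D *m A) *m U)^T; rewrite -trmx_mul.
move: (D *m A) AE => B AE; rewrite Us.2 !mulmxA (mulmxtVK _ Us.1).
by rewrite -(mulmxA _ _ B) -AE -rhoE.
Qed.

Lemma mxtrace_mul_mxln n (rho A U : 'M[C]_n) (d p : 'I_n -> R) :
  diagonalizes U d A -> (forall j, (U *m rho *m U ^t*) j j = (p j)%:C) ->
  \tr (rho *m mxln A) = (\sum_j p j * ln (d j))%:C.
Proof.
move=> Ud Up; rewrite /mxln (mxfun_diagonalizes _ Ud) !mulmxA mxtrace_mul_diag.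
rewrite rmorph_sum; apply: eq_bigr => j _.
by rewrite mulmxA Up -rmorphM mulrC.
Qed.

Lemma mono_add_ge_qrelent
  (DQ : forall n : nat, 'M[C]_n -> 'M[C]_n -> \bar R)
  (DQ_range : forall (n : nat) (rho sigma : 'M[C]_n),
     density rho -> density sigma -> DQ n rho sigma <> -oo%E)
  (DQ_mono : forall (n m : nat) (L : {linear 'M[C]_n -> 'M[C]_m})
     (rho sigma : 'M[C]_n),
     cptp L -> density rho -> density sigma ->
     (DQ m (L rho) (L sigma) <= DQ n rho sigma)%E)
  (DQ_norm : forall (n : nat) (p q : 'I_n -> R),
     prob_dist p -> prob_dist q ->
     DQ n (diag_op p) (diag_op q) = crelent p q)
  (DQ_add : forall (n : nat) (rho sigma : 'M[C]_n) (k : nat),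
     (1 <= k)%N -> density rho -> density sigma ->
     DQ (n ^ k)%N (ntensmx rho k) (ntensmx sigma k) =
     (k%:R%:E * DQ n rho sigma)%E)
  n (rho sigma : 'M[C]_n) :
  density rho -> density sigma -> (qrelent rho sigma <= DQ n rho sigma)%E.
Proof.
move=> dr ds; have [pr ps] := (dr.1, ds.1).
have [U [s [Us s0]]] := psdmx_diagonalizes ps.
have [W [lam [Wl lam0]]] := psdmx_diagonalizes pr.
have pA : psdmx (U *m rho *m U ^t*).
  by rewrite -{1}[U]trmxCK; exact: psdmx_conj.
have [p [Up p0]] := psdmx_diag_real pA.
have sE l : (U *m sigma *m U ^t*) l l = (s l)%:C.
  by rewrite (diagonalizes_conj Us) diag_op_diag.
rewrite /qrelent; case: (supp_subP pr Us Up) => [sp|nsp]; last first.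
  (* Without support inclusion, measuring in the eigenbasis of [sigma] already gives classical
     relative entropy +oo. *)
  apply: le_trans (crelent_le_mono DQ_mono DQ_norm dr ds Us.1 Up sE).
  rewrite /crelent; case: ifPn => // /forallP sp; exfalso; apply: nsp => j sj.
  by have := sp j; rewrite sj eqxx => /eqP.
have lamE j : (W *m rho *m W ^t*) j j = (lam j)%:C.
  by rewrite (diagonalizes_conj Wl) diag_op_diag.
have -> : \tr (rho *m (mxln rho - mxln sigma)) =
    (\sum_j lam j * ln (lam j) - \sum_j p j * ln (s j))%:C.
  rewrite mxtrace_mulmxBr [X in X - _](mxtrace_mul_mxln Wl lamE).
  by rewrite [X in _ - X](mxtrace_mul_mxln Us Up) -rmorphB.
rewrite /=.
set H := \sum_j lam j * _; set K := \sum_j p j * _.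
have lam1 : \sum_j lam j = 1.
  by apply: complexI; rewrite -(diagonalizes_tr Wl) dr.2.
have p1 : \sum_j p j = 1.
  apply: complexI; rewrite rmorph1 -dr.2 rmorph_sum.
  rewrite -[in RHS](mulmx1 rho) -(unitary_adjM Us.1) mulmxA mxtrace_mulC mulmxA.
  by apply: eq_bigr => j _; rewrite Up.
have J : joint_spectrum rho sigma U W s lam p by split=> //; split=> //; split.
case DE : (DQ n rho sigma) => [x||]; last 2 first.
- exact: leey.
- by have := DQ_range _ _ _ dr ds.
(* It suffices that k + 1 copies leave an error of at most n ln(k + 2). *)
rewrite lee_fin -subr_le0; apply: (@le0_of_ln_growth _ n%:R) => // k.
have [U' [W' [s' [lam' [p' [c [J' s'E cE HE KE]]]]]]] := joint_spectrum_ntensmx k J.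
(* Labels are tuples of multiplicities, each between 0 and k + 1, so [inord] alters nothing. There
   are (k + 2)^n labels, and each determines the eigenvalue. *)
pose T := {ffun 'I_n -> 'I_k.+2}.
pose c' j : T := [ffun x => inord (c j x)].
pose g (f : T) := \prod_x s x ^+ f x.
have s'g j : s' j = g (c' j).
  by rewrite s'E; apply: eq_bigr => y _; rewrite ffunE inordK // ltnS.
have [[l0 _] _ _] := joint_lam J'.
have := pinching_bound DQ_mono DQ_norm (density_ntensmx k dr) (density_ntensmx k ds)
  (joint_sigma J') (joint_rho J') l0 (joint_diag J') s'g.
rewrite DQ_add // DE -EFinM lee_fin HE KE card_ffun !card_ord natrX lnXn //.
rewrite -mulr_natl => h; rewrite mulrBr; rewrite -/H -/K in h; lra.
Qed.

End LowerBound.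

Theorem theorem2p2 (R : realType)
  (DQ : forall n : nat, 'M[R[i]]_n -> 'M[R[i]]_n -> \bar R)
  (DQ_range : forall (n : nat) (rho sigma : 'M[R[i]]_n),
     density rho -> density sigma -> DQ n rho sigma <> -oo%E)
  (DQ_mono : forall (n m : nat) (L : {linear 'M[R[i]]_n -> 'M[R[i]]_m})
     (rho sigma : 'M[R[i]]_n),
     cptp L -> density rho -> density sigma ->
     (DQ m (L rho) (L sigma) <= DQ n rho sigma)%E)
  (DQ_norm : forall (n : nat) (p q : 'I_n -> R),
     prob_dist p -> prob_dist q ->
     DQ n (diag_op p) (diag_op q) = crelent p q)
  (DQ_add : forall (n : nat) (rho sigma : 'M[R[i]]_n) (k : nat),
     (1 <= k)%N -> density rho -> density sigma ->
     DQ (n ^ k)%N (ntensmx rho k) (ntensmx sigma k) =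
     (k%:R%:E * DQ n rho sigma)%E)
  (n : nat) (rho sigma : 'M[R[i]]_n)
  (rho_density : density rho) (sigma_density : density sigma) :
  (qrelent rho sigma <= DQ n rho sigma)%E /\
  (DQ n rho sigma <= qrelentR rho sigma)%E.
Proof.
split; last exact: mono_le_qrelentR.
exact: mono_add_ge_qrelent.
Qed.
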